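(* Let $\lambda\in\mathbb{C}$ with $\operatorname{Re}\lambda\in[0,\tfrac12]$ and $|\operatorname{Im}\lambda|\ge 380$. Then there is no unstable mode for $\lambda$, i.e. there is no nontrivial (not identically zero) complex-valued function $u_\lambda\in C^\infty[0,1]$ satisfying $$-(1-\rho^2)u_\lambda''(\rho)-2\frac{1-\rho^2}{\rho}u_\lambda'(\rho)+2\lambda\rho\, u_\lambda'(\rho)+\lambda(\lambda+1)u_\lambda(\rho)+\frac{V(\rho)}{\rho^2}u_\lambda(\rho)=0\qquad\text{for }\rho\in(0,1),$$ where $V(\rho)=2\cos(4\arctan\rho)=\frac{2(1-6\rho^2+\rho^4)}{(1+\rho^2)^2}$.
   Context: An unstable mode for $\lambda\in\mathbb{C}$ with $\operatorname{Re}\lambda\ge0$ is a nontrivial solution $u_\lambda\in C^\infty[0,1]$ of the ODE in the claim. $C^\infty[0,1]$ denotes complex-valued functions smooth up to and including the endpoints. *)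

(* Defs.v *)
From Stdlib Require Import Reals Lra.
From Coquelicot Require Import Coquelicot.
Open Scope R_scope.

(* [l] is the derivative at [x] of [f] restricted to the set [D]: one-sided at
   the endpoints when [D] is a segment, and independent of [f] outside [D]. *)
Definition is_derive_within (D : R -> Prop) (f : R -> C) (x : R) (l : C) : Prop :=
  filterdiff (U := R_NormedModule) (V := C_R_NormedModule)
    f (within D (locally x)) (fun h : R => scal h l).

(* [d n] is the [n]-th derivative of [u] on [a,b]. *)
Definition smooth_on_segment (a b : R) (u : R -> C) : Prop :=
  exists d : nat -> R -> C,
    (forall x, a <= x <= b -> d 0%nat x = u x) /\
    (forall n x, a <= x <= b ->
       is_derive_within (fun y => a <= y <= b) (d n) x (d (S n) x)).

(* Total operator; it is the [n]-th derivative wherever [u] is smooth. *)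
Definition CDerive_n (u : R -> C) (n : nat) (x : R) : C :=
  (Derive_n (fun t => Re (u t)) n x, Derive_n (fun t => Im (u t)) n x).

Definition V (rho : R) : R := 2 * cos (4 * atan rho).

Lemma V_rational (rho : R) :
  V rho = 2 * (1 - 6 * rho ^ 2 + rho ^ 4) / (1 + rho ^ 2) ^ 2.
Proof.
assert (H0 : 0 < 1 + rho ^ 2) by nra.
assert (Hc : cos (atan rho) ^ 2 = / (1 + rho ^ 2)).
{ rewrite cos_atan.
  replace (1 + rho²) with (1 + rho ^ 2) by (unfold Rsqr; ring).
  unfold Rdiv; rewrite Rmult_1_l, pow_inv, pow2_sqrt; [reflexivity | lra]. }
unfold V.
replace (4 * atan rho) with (2 * (2 * atan rho)) by ring.
rewrite (cos_2a_cos (2 * atan rho)), (cos_2a_cos (atan rho)).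
replace (2 * cos (atan rho) * cos (atan rho)) with (2 * cos (atan rho) ^ 2) by ring.
rewrite Hc; field; lra.
Qed.

Definition mode_equation (lam : C) (u : R -> C) (rho : R) : Prop :=
  (- RtoC (1 - rho ^ 2) * CDerive_n u 2 rho
   - RtoC (2 * ((1 - rho ^ 2) / rho)) * CDerive_n u 1 rho
   + RtoC 2 * lam * RtoC rho * CDerive_n u 1 rho
   + lam * (lam + RtoC 1) * u rho
   + RtoC (V rho / rho ^ 2) * u rho
   = RtoC 0)%C.

Definition unstable_mode (lam : C) (u : R -> C) : Prop :=
  0 <= Re lam /\
  smooth_on_segment 0 1 u /\
  (exists rho, 0 <= rho <= 1 /\ u rho <> RtoC 0) /\
  (forall rho, 0 < rho < 1 -> mode_equation lam u rho).

(* Main.v *)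
Require Import Defs.
From Stdlib Require Import Reals.
From Coquelicot Require Import Coquelicot.
From Stdlib Require Import Lra.
Open Scope R_scope.

(* Put k = 1 - lam and T = |Im lam|. Since V / x^2 = 2 / x^2 - 16 / (1 + x^2)^2, the
   equation is the free l = 1 wave equation plus a bounded potential. Dividing by the
   free solution that is smooth at x = 1, namely k - 1/x up to elementary factors,
   gives a function h that vanishes at 0, because the free solution blows up there
   while the mode does not, and that satisfies
     (1 - x^2) h'' + 2 c h' + q h = 0,  q = 16 / (1 + x^2)^2,
   with c = k - x + (1 - x^2) / (x (k x - 1)) of size at least comparable to T.
   For large T the solutions smooth at 1 are slow, h' ~ - q h / (2 c), as opposed to
   the rapidly oscillating ones that behave like (1 - x)^k. Let b be a close
   approximation of - q / (2 c) and r = h' - b h. Smoothness forces r = 0 at x = 1,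
   and integrating the equation of r back from 1, where its homogeneous part is
   controlled thanks to Re k <= 1, gives |r| <= 0.6 max |h|. Integrating
   h' = b h + r from h(0) = 0 then yields max |h| <= 0.7 max |h|, so h = 0. *)

(** * Complex-valued functions of a real variable *)

Definition cderive (f : R -> C) (x : R) (l : C) : Prop :=
  is_derive (fun t => Re (f t)) x (Re l) /\ is_derive (fun t => Im (f t)) x (Im l).

Definition ccont (f : R -> C) (x : R) : Prop :=
  continuity_pt (fun t => Re (f t)) x /\ continuity_pt (fun t => Im (f t)) x.

Lemma C_ext (z w : C) : Re z = Re w -> Im z = Im w -> z = w.
Proof. destruct z, w; simpl; intros -> ->; reflexivity. Qed.

Lemma Cmod2 (z : C) : Cmod z ^ 2 = Re z ^ 2 + Im z ^ 2.
Proof. unfold Cmod; rewrite pow2_sqrt; [reflexivity | unfold Re, Im; nra]. Qed.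

Lemma Im_le_Cmod (z : C) : Rabs (Im z) <= Cmod z.
Proof. apply Rle_trans with (2 := Rmax_Cmod z), Rmax_r. Qed.

Lemma dot_le_Cmod (z w : C) : Re z * Re w + Im z * Im w <= Cmod z * Cmod w.
Proof.
replace (Re z * Re w + Im z * Im w) with (Re (Cconj z * w)%C) by (simpl; unfold Re, Im; ring).
rewrite <- (Cmod_conj z), <- Cmod_mult.
apply Rle_trans with (2 := re_le_Cmod _), Rle_abs.
Qed.

Lemma RtoC_neq0 (x : R) : x <> 0 -> RtoC x <> RtoC 0.
Proof. intros Hx E; apply Hx, RtoC_inj, E. Qed.

Lemma Re_div_real (z : C) (r : R) : r <> 0 -> Re (z / RtoC r)%C = Re z / r.
Proof. intros Hr; destruct z; unfold Re; simpl; field; exact Hr. Qed.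

Lemma Cmod_quot_le (r b : R) (z : C) :
  0 < b -> b <= Cmod z -> Cmod (RtoC r / z)%C <= Rabs r / b.
Proof.
intros Hb Hz.
assert (z <> RtoC 0) by (apply Cmod_gt_0; lra).
rewrite Cmod_div, Cmod_R by assumption.
apply Rmult_le_compat_l; [apply Rabs_pos|].
apply Rinv_le_contravar; assumption.
Qed.

Lemma cderive_ccont f x l : cderive f x l -> ccont f x.
Proof.
intros [H1 H2]; split; apply derivable_continuous_pt; eexists;
  apply is_derive_Reals; eassumption.
Qed.

Lemma cderive_eq f x l l' : cderive f x l -> l = l' -> cderive f x l'.
Proof. intros H <-; exact H. Qed.

Lemma cderive_const z x : cderive (fun _ => z) x (RtoC 0).
Proof. split; apply (is_derive_const (V := R_NormedModule)). Qed.

Lemma cderive_RtoC (f : R -> R) x l :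
  is_derive f x l -> cderive (fun t => RtoC (f t)) x (RtoC l).
Proof. intros H; split; simpl; [exact H | apply (is_derive_const (V := R_NormedModule))]. Qed.

Lemma cderive_id x : cderive (fun t => RtoC t) x (RtoC 1).
Proof. apply (cderive_RtoC (fun t => t)), (is_derive_id (K := R_AbsRing)). Qed.

Lemma cderive_plus f g x l m :
  cderive f x l -> cderive g x m -> cderive (fun t => f t + g t)%C x (l + m)%C.
Proof.
intros [H1 H2] [H3 H4]; split; simpl; apply (is_derive_plus (V := R_NormedModule)); assumption.
Qed.

Lemma cderive_minus f g x l m :
  cderive f x l -> cderive g x m -> cderive (fun t => f t - g t)%C x (l - m)%C.
Proof.
intros [H1 H2] [H3 H4]; split; simpl; apply (is_derive_minus (V := R_NormedModule)); assumption.
Qed.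

Lemma cderive_opp f x l : cderive f x l -> cderive (fun t => - f t)%C x (- l)%C.
Proof. intros [H1 H2]; split; simpl; apply (is_derive_opp (V := R_NormedModule)); assumption. Qed.

Lemma is_derive_Rmult (f g : R -> R) x l m :
  is_derive f x l -> is_derive g x m ->
  is_derive (fun t => f t * g t) x (l * g x + f x * m).
Proof.
intros H1 H2; apply (is_derive_mult f g x l m H1 H2), Rmult_comm.
Qed.

Lemma cderive_mult f g x l m :
  cderive f x l -> cderive g x m ->
  cderive (fun t => f t * g t)%C x (l * g x + f x * m)%C.
Proof.
intros [H1 H2] [H3 H4]; split.
- apply (is_derive_ext (fun t => Re (f t) * Re (g t) - Im (f t) * Im (g t))).
    intros t; reflexivity.
  replace (Re _) with ((Re l * Re (g x) + Re (f x) * Re m)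
    - (Im l * Im (g x) + Im (f x) * Im m)) by (simpl; unfold Re, Im; ring).
  apply (is_derive_minus (V := R_NormedModule)); apply is_derive_Rmult; assumption.
- apply (is_derive_ext (fun t => Re (f t) * Im (g t) + Im (f t) * Re (g t))).
    intros t; reflexivity.
  replace (Im _) with ((Re l * Im (g x) + Re (f x) * Im m)
    + (Im l * Re (g x) + Im (f x) * Re m)) by (simpl; unfold Re, Im; ring).
  apply (is_derive_plus (V := R_NormedModule)); apply is_derive_Rmult; assumption.
Qed.

Lemma Csq_neq0 (z : C) : z <> RtoC 0 -> Re z ^ 2 + Im z ^ 2 <> 0.
Proof.
intros Hz E; apply Hz, C_ext; simpl; nra.
Qed.

Lemma cderive_inv f x l :
  cderive f x l -> f x <> RtoC 0 ->
  cderive (fun t => / f t)%C x (- l / (f x * f x))%C.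
Proof.
intros [H1 H2] Hx.
pose proof (Csq_neq0 _ Hx) as Hn.
assert (Hq : is_derive (fun t => Re (f t) ^ 2 + Im (f t) ^ 2) x
  (2 * (Re (f x) * Re l + Im (f x) * Im l))).
{ apply (is_derive_ext (fun t => Re (f t) * Re (f t) + Im (f t) * Im (f t))).
    intros t; simpl; ring.
  replace (2 * _) with ((Re l * Re (f x) + Re (f x) * Re l)
    + (Im l * Im (f x) + Im (f x) * Im l)) by ring.
  apply (is_derive_plus (V := R_NormedModule)); apply is_derive_Rmult; assumption. }
assert (Hn2 : (Re (f x) * Re (f x) - Im (f x) * Im (f x)) ^ 2
   + (Re (f x) * Im (f x) + Im (f x) * Re (f x)) ^ 2 <> 0).
{ replace (_ + _) with ((Re (f x) ^ 2 + Im (f x) ^ 2) ^ 2) by ring.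
  apply pow_nonzero, Hn. }
split.
- apply (is_derive_ext (fun t => Re (f t) / (Re (f t) ^ 2 + Im (f t) ^ 2))).
    intros t; reflexivity.
  replace (Re (- l / (f x * f x))%C) with
   ((Re l * (Re (f x) ^ 2 + Im (f x) ^ 2)
     - Re (f x) * (2 * (Re (f x) * Re l + Im (f x) * Im l))) / (Re (f x) ^ 2 + Im (f x) ^ 2) ^ 2).
  apply (is_derive_div (fun t => Re (f t)) (fun t => Re (f t) ^ 2 + Im (f t) ^ 2)); [exact H1|idtac|]. exact Hq. exact Hn.
  revert Hn Hn2; destruct (f x), l; simpl; intros; field; rewrite ?Rmult_1_r in *; split; assumption.
- apply (is_derive_ext (fun t => - Im (f t) / (Re (f t) ^ 2 + Im (f t) ^ 2))).
    intros t; reflexivity.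
  replace (Im (- l / (f x * f x))%C) with
   ((- Im l * (Re (f x) ^ 2 + Im (f x) ^ 2)
     - - Im (f x) * (2 * (Re (f x) * Re l + Im (f x) * Im l))) / (Re (f x) ^ 2 + Im (f x) ^ 2) ^ 2).
  apply (is_derive_div (fun t => - Im (f t)) (fun t => Re (f t) ^ 2 + Im (f t) ^ 2));
    [apply (is_derive_opp (V := R_NormedModule)) | |]; assumption.
  revert Hn Hn2; destruct (f x), l; simpl; intros; field; rewrite ?Rmult_1_r in *; split; assumption.
Qed.

Lemma cderive_div f g x l m :
  cderive f x l -> cderive g x m -> g x <> RtoC 0 ->
  cderive (fun t => f t / g t)%C x ((l * g x - f x * m) / (g x * g x))%C.
Proof.
intros Hf Hg Hx; unfold Cdiv at 1.
apply (cderive_eq _ _ _ _ (cderive_mult _ _ _ _ _ Hf (cderive_inv _ _ _ Hg Hx))).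
field; exact Hx.
Qed.

Lemma ccont_plus f g x : ccont f x -> ccont g x -> ccont (fun t => f t + g t)%C x.
Proof. intros [H1 H2] [H3 H4]; split; simpl; apply continuity_pt_plus; assumption. Qed.

Lemma ccont_minus f g x : ccont f x -> ccont g x -> ccont (fun t => f t - g t)%C x.
Proof. intros [H1 H2] [H3 H4]; split; simpl; apply continuity_pt_minus; assumption. Qed.

Lemma ccont_mult f g x : ccont f x -> ccont g x -> ccont (fun t => f t * g t)%C x.
Proof.
intros [H1 H2] [H3 H4]; split.
- apply (continuity_pt_minus (fun t => Re (f t) * Re (g t)) (fun t => Im (f t) * Im (g t)));
  apply continuity_pt_mult; assumption.
- apply (continuity_pt_plus (fun t => Re (f t) * Im (g t)) (fun t => Im (f t) * Re (g t)));
  apply continuity_pt_mult; assumption.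
Qed.

Lemma ccont_inv f x : ccont f x -> f x <> RtoC 0 -> ccont (fun t => / f t)%C x.
Proof.
intros [H1 H2] Hx.
pose proof (Csq_neq0 _ Hx) as Hn.
assert (Hq : continuity_pt (fun t => Re (f t) ^ 2 + Im (f t) ^ 2) x).
{ apply (continuity_pt_ext (fun t => Re (f t) * Re (f t) + Im (f t) * Im (f t))).
    intros t; ring.
  apply continuity_pt_plus; apply continuity_pt_mult; assumption. }
split.
- apply (continuity_pt_div (fun t => Re (f t))); assumption.
- apply (continuity_pt_div (fun t => - Im (f t))); [apply continuity_pt_opp| |]; assumption.
Qed.

Lemma ccont_div f g x :
  ccont f x -> ccont g x -> g x <> RtoC 0 -> ccont (fun t => f t / g t)%C x.
Proof. intros Hf Hg Hx; apply ccont_mult, ccont_inv; assumption. Qed.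

Lemma ccont_const z x : ccont (fun _ => z) x.
Proof. apply (cderive_ccont _ _ _ (cderive_const z x)). Qed.

Lemma ccont_opp f x : ccont f x -> ccont (fun t => - f t)%C x.
Proof. intros [H1 H2]; split; simpl; apply continuity_pt_opp; assumption. Qed.

Lemma ccont_id x : ccont (fun t => RtoC t) x.
Proof. apply (cderive_ccont _ _ _ (cderive_id x)). Qed.

Ltac ccont_tac := repeat first
  [ apply ccont_const | apply ccont_id | assumption
  | apply ccont_minus | apply ccont_plus | apply ccont_mult | apply ccont_opp ].

(** Endpoint values are limits of interior ones. This extends the mode equation to [x = 1], where it
    acts as a boundary condition, and the vanishing of the mode to [x = 0]. *)
Lemma ccont_zero_closure f p :
  0 <= p <= 1 -> ccont f p -> (forall x, 0 < x < 1 -> f x = RtoC 0) -> f p = RtoC 0.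
Proof.
intros Hp.
assert (H : forall g : R -> R, continuity_pt g p ->
   (forall x, 0 < x < 1 -> g x = 0) -> g p = 0).
{ intros g Hc Hz; destruct (Req_dec (g p) 0) as [E|N]; [exact E|exfalso].
  (* The test point is [p] moved towards [1 / 2] by a fraction [e]: it lies in the open interval, at
     distance at most [e / 2]. It must differ from [p], since [continuity_pt] tests only other
     points. *)
  destruct (Req_dec p (1 / 2)) as [E|Np]; [apply N, Hz; lra|].
  destruct (Hc (Rabs (g p))) as [d [Hd Hx]]; [apply Rabs_pos_lt, N|].
  set (e := Rmin d 1).
  assert (He : 0 < e <= 1) by (split; [apply Rmin_pos; lra|apply Rmin_r]).
  assert (He' : e <= d) by apply Rmin_l.
  specialize (Hx (p + e * (1 / 2 - p))).
  rewrite (Hz (p + e * (1 / 2 - p))) in Hx by nra.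
  simpl in Hx; unfold R_dist, Rminus in Hx.
  rewrite Rplus_0_l, Rabs_Ropp in Hx.
  apply (Rlt_irrefl (Rabs (g p))), Hx; split.
  - split; [exact I | nra].
  - apply Rabs_def1; nra. }
intros [H1 H2] Hz; apply C_ext; apply (H (fun t => _ (f t))); try assumption;
  intros x Hx; rewrite (Hz x Hx); reflexivity.
Qed.

Lemma nonincreasing_of_derive (f df : R -> R) (a b : R) :
  a <= b -> (forall x, a <= x <= b -> continuity_pt f x) ->
  (forall x, a < x < b -> is_derive f x (df x) /\ df x <= 0) -> f b <= f a.
Proof.
intros Hab Hc Hd.
destruct (Req_dec a b) as [->|N]; [lra|].
assert (pr : forall c, a < c < b -> derivable_pt f c).
{ intros c Hx; exists (df c); apply is_derive_Reals, Hd, Hx. }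
destruct (MVT f id a b pr (fun c _ => derivable_pt_id c)) as [c [P E]].
- lra.
- exact Hc.
- intros c _; apply derivable_continuous_pt, derivable_pt_id.
- rewrite derive_pt_id in E; unfold id in E.
  assert (Hdf : derive_pt f c (pr c P) = df c).
  { apply derive_pt_eq_0, is_derive_Reals, Hd, P. }
  rewrite Hdf in E; destruct (Hd c P) as [_ Hle]; nra.
Qed.

(* The modulus is replaced by [sqrt (|z|^2 + e^2)], which is differentiable
   at the zeros of [z]; [s = 1] bounds growth and [s = -1] bounds decay. *)
Lemma Cmod_growth (z z' : R -> C) (K k : R -> R) (s a b : R) :
  s = 1 \/ s = -1 -> a <= b ->
  (forall x, a <= x <= b -> ccont z x) ->
  (forall x, a <= x <= b -> continuity_pt K x) ->
  (forall x, a < x < b -> cderive z x (z' x) /\ is_derive K x (k x) /\ 0 <= k x /\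
     s * (Re (z x) * Re (z' x) + Im (z x) * Im (z' x)) <= k x * Cmod (z x)) ->
  s * (Cmod (z b) - Cmod (z a)) <= K b - K a.
Proof.
intros Hs Hab Hc HK Hd.
assert (He : forall e, 0 < e ->
  s * (Cmod (z b) - Cmod (z a)) <= K b - K a + 2 * e).
{ intros e He.
  set (S := fun x => sqrt (Re (z x) * Re (z x) + Im (z x) * Im (z x) + e ^ 2)).
  assert (HS : forall x, Cmod (z x) <= S x <= Cmod (z x) + e).
  { intros x; unfold S.
    replace (Re (z x) * Re (z x) + Im (z x) * Im (z x)) with (Cmod (z x) ^ 2)
      by (rewrite Cmod2; ring).
    pose proof (Cmod_ge_0 (z x)); split.
    - rewrite <- (sqrt_pow2 (Cmod (z x))) at 1 by assumption.
      apply sqrt_le_1_alt; nra.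
    - rewrite <- (sqrt_pow2 (Cmod (z x) + e)) by lra.
      apply sqrt_le_1_alt; nra. }
  assert (Hpos : forall x, 0 < Re (z x) * Re (z x) + Im (z x) * Im (z x) + e ^ 2)
    by (intros x; nra).
  assert (H : s * S b - K b <= s * S a - K a).
  { apply (nonincreasing_of_derive (fun x => s * S x - K x)
      (fun x => s * ((Re (z x) * Re (z' x) + Im (z x) * Im (z' x)) / S x) - k x)); [exact Hab| |].
    - intros x Hx; destruct (Hc x Hx) as [C1 C2].
      apply continuity_pt_minus; [|apply HK, Hx].
      apply continuity_pt_mult; [apply continuity_pt_const; intros ? ?; reflexivity|].
      apply (continuity_pt_comp (fun x => Re (z x) * Re (z x) + Im (z x) * Im (z x) + e ^ 2) sqrt).
      + apply continuity_pt_plus;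
          [|apply continuity_pt_const; intros ? ?; reflexivity].
        apply continuity_pt_plus; apply continuity_pt_mult; assumption.
      + apply continuity_pt_sqrt, Rlt_le, Hpos.
    - intros x Hx; destruct (Hd x Hx) as [[D1 D2] [D3 [Hk Hb]]].
      assert (HSp : 0 < S x) by apply sqrt_lt_R0, Hpos.
      split.
      + apply (is_derive_minus (V := R_NormedModule)); [|exact D3].
        apply is_derive_scal.
        replace ((Re (z x) * Re (z' x) + Im (z x) * Im (z' x)) / S x) with
          ((Re (z' x) * Re (z x) + Re (z x) * Re (z' x)
            + (Im (z' x) * Im (z x) + Im (z x) * Im (z' x)) + 0) / (2 * S x))
          by (field; lra).
        apply (is_derive_sqrt
          (fun x => Re (z x) * Re (z x) + Im (z x) * Im (z x) + e ^ 2)); [|apply Hpos].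
        apply (is_derive_plus (V := R_NormedModule));
          [|apply (is_derive_const (V := R_NormedModule))].
        apply (is_derive_plus (V := R_NormedModule)); apply is_derive_Rmult; assumption.
      + enough (s * (Re (z x) * Re (z' x) + Im (z x) * Im (z' x)) / S x <= k x)
          by (unfold Rdiv in *; lra).
        apply Rle_div_l; [exact HSp|].
        apply Rle_trans with (1 := Hb), Rmult_le_compat_l; [exact Hk|apply HS]. }
  pose proof (HS a); pose proof (HS b).
  destruct Hs as [-> | ->]; lra. }
apply Rnot_lt_le; intros Hlt.
(* With [e] a quarter of the supposed excess, the error [2 * e] is half of it. *)
specialize (He ((s * (Cmod (z b) - Cmod (z a)) - (K b - K a)) / 4)); lra.
Qed.

(** * Smooth functions on the unit segment *)

Definition clamp (x : R) : R := Rmax 0 (Rmin 1 x).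

Lemma clamp_range x : 0 <= clamp x <= 1.
Proof.
unfold clamp; split; [apply Rmax_l|].
apply Rmax_lub; [lra|apply Rmin_l].
Qed.

Lemma clamp_id x : 0 <= x <= 1 -> clamp x = x.
Proof. intros H; unfold clamp; rewrite Rmin_right, Rmax_right; lra. Qed.

Lemma clamp_lipschitz x y : Rabs (clamp y - clamp x) <= Rabs (y - x).
Proof.
unfold clamp, Rmax, Rmin.
repeat destruct Rle_dec; unfold Rabs; repeat destruct Rcase_abs; lra.
Qed.

(** Differentiability within the segment gives continuity within it, and [clamp] is a 1-Lipschitz
    map of the line into the segment. *)
Lemma is_derive_within_continuous (f : R -> C) (df : R -> C) :
  (forall x, 0 <= x <= 1 -> is_derive_within (fun y => 0 <= y <= 1) f x (df x)) ->
  forall x, ccont (fun t => f (clamp t)) x.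
Proof.
intros H x.
pose proof (clamp_range x) as Hr.
assert (Hl : filterlim f (within (fun y => 0 <= y <= 1) (locally (clamp x)))
   (locally (f (clamp x)))).
{ apply (filterdiff_continuous_aux (K := R_AbsRing) (U := R_NormedModule)
    (V := C_R_NormedModule) (FF := within_filter _ _ _ _) f).
  - eexists; exact (H _ Hr).
  - intros P HP; apply (filter_le_within (fun y => 0 <= y <= 1)), HP. }
assert (Hc : filterlim clamp (locally x)
   (within (fun y => 0 <= y <= 1) (locally (clamp x)))).
{ intros P [e He]; exists e; intros y Hy; apply He; [|apply clamp_range].
  apply Rle_lt_trans with (2 := Hy), clamp_lipschitz. }
pose proof (filterlim_comp _ _ _ _ _ _ _ _ Hc Hl) as Hf.
split; apply continuity_pt_filterlim;
  apply (filterlim_comp _ _ _ _ _ _ _ _ Hf).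
- apply (continuous_fst (U := R_UniformSpace) (V := R_UniformSpace)).
- apply (continuous_snd (U := R_UniformSpace) (V := R_UniformSpace)).
Qed.

Lemma locally_open_interval (P : R -> Prop) a b x :
  a < x < b -> (forall y, a < y < b -> P y) -> locally x P.
Proof.
intros Hx HP.
apply (filter_imp (fun y => a < y /\ y < b)); [exact HP|].
apply filter_and; [apply open_gt|apply open_lt]; lra.
Qed.

(** The segment is a neighbourhood of an interior point, so restricting the filter changes nothing;
    real and imaginary parts follow by composing with the linear projections. *)
Lemma is_derive_within_interior (f : R -> C) x l :
  0 < x < 1 -> is_derive_within (fun y => 0 <= y <= 1) f x l -> cderive f x l.
Proof.
intros Hx H.
assert (Hd : is_derive (V := C_R_NormedModule) f x l).
{ destruct H as [Hlin Hdom]; split; [exact Hlin|].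
  intros y Hy eps.
  assert (Hy' : is_filter_lim (within (fun y => 0 <= y <= 1) (locally x)) y).
  { intros P HP; apply (filter_le_within (fun y => 0 <= y <= 1)), Hy, HP. }
  specialize (Hdom y Hy' eps); unfold within in Hdom.
  assert (H01 : locally x (fun y => 0 <= y <= 1)).
  { apply (locally_open_interval _ 0 1); [exact Hx|intros; lra]. }
  apply (filter_imp _ _ (fun y (H : _ /\ _) => proj2 H (proj1 H))
    (filter_and _ _ H01 Hdom)). }
split.
- apply (filterdiff_ext_lin (K := R_AbsRing) (U := R_NormedModule) (V := R_NormedModule)
    _ (fun y : R => fst (scal (V := C_R_NormedModule) y l))).
  + apply (filterdiff_comp' (U := R_NormedModule) (V := C_R_NormedModule)
      (W := R_NormedModule) f fst x _ fst Hd).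
    apply filterdiff_linear, is_linear_fst.
  + intros y; reflexivity.
- apply (filterdiff_ext_lin (K := R_AbsRing) (U := R_NormedModule) (V := R_NormedModule)
    _ (fun y : R => snd (scal (V := C_R_NormedModule) y l))).
  + apply (filterdiff_comp' (U := R_NormedModule) (V := C_R_NormedModule)
      (W := R_NormedModule) f snd x _ snd Hd).
    apply filterdiff_linear, is_linear_snd.
  + intros y; reflexivity.
Qed.

(* Composing with [clamp] makes the derivatives of [u] continuous on the whole
   line without changing them on [0,1], so that two-sided continuity is available
   at the endpoints. *)
Lemma smooth_on_unit_segment (u : R -> C) :
  smooth_on_segment 0 1 u ->
  exists v0 v1 v2 : R -> C,
    (forall x, 0 <= x <= 1 -> v0 x = u x) /\
    (forall x, ccont v0 x /\ ccont v1 x /\ ccont v2 x) /\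
    (forall x, 0 < x < 1 -> cderive v0 x (v1 x) /\ cderive v1 x (v2 x) /\
       CDerive_n u 1 x = v1 x /\ CDerive_n u 2 x = v2 x).
Proof.
intros [d [H0 Hd]].
assert (Hc : forall n x, ccont (fun t => d n (clamp t)) x).
{ intros n; apply is_derive_within_continuous with (d (S n)), Hd. }
assert (HD : forall n x, 0 < x < 1 -> cderive (fun t => d n (clamp t)) x (d (S n) (clamp x))).
{ intros n x Hx; rewrite clamp_id by lra.
  destruct (is_derive_within_interior _ _ _ Hx (Hd n x ltac:(lra))) as [D1 D2].
  split; (eapply is_derive_ext_loc; [|eassumption]);
    apply (locally_open_interval _ 0 1); try exact Hx;
    intros y Hy; simpl; rewrite clamp_id by lra; reflexivity. }
exists (fun t => d 0%nat (clamp t)), (fun t => d 1%nat (clamp t)), (fun t => d 2%nat (clamp t)).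
(* [Derive_n] of order 2 differentiates the function [Derive], so the first derivative has to be
   identified on a whole neighbourhood. *)
assert (HR : forall x, 0 < x < 1 ->
  Derive (fun t => Re (u t)) x = Re (d 1%nat (clamp x)) /\
  Derive (fun t => Im (u t)) x = Im (d 1%nat (clamp x))).
{ intros x Hx; destruct (HD 0%nat x Hx) as [D1 D2].
  rewrite <- (is_derive_unique _ _ _ D1), <- (is_derive_unique _ _ _ D2).
  split; apply Derive_ext_loc, (locally_open_interval _ 0 1); try exact Hx;
    intros y Hy; rewrite clamp_id, H0 by lra; reflexivity. }
split; [|split; [intros x; split; [|split]; apply Hc|intros x H; split; [|split; [|split]]]].
- intros x Hx; rewrite clamp_id by exact Hx; apply H0, Hx.
- apply HD, H.
- apply HD, H.
- apply C_ext; apply HR, H.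
- destruct (HD 1%nat x H) as [D1 D2].
  apply C_ext; simpl.
  + rewrite <- (is_derive_unique _ _ _ D1); apply Derive_ext_loc.
    apply (locally_open_interval _ 0 1); [exact H|]; intros y Hy; apply HR, Hy.
  + rewrite <- (is_derive_unique _ _ _ D2); apply Derive_ext_loc.
    apply (locally_open_interval _ 0 1); [exact H|]; intros y Hy; apply HR, Hy.
Qed.

(** * Division by the free solution *)

Section Algebra.
Open Scope C_scope.

(* The mode equation at [lam = 1 - k], multiplied by [x^2 (1 + x^2)^2]. *)
Definition cleared_equation (k x u u1 u2 : C) : C :=
  - (1 - x * x) * (x * x) * ((1 + x * x) * (1 + x * x)) * u2
  - 2 * (1 - x * x) * x * ((1 + x * x) * (1 + x * x)) * u1
  + 2 * (1 - k) * (x * x * x) * ((1 + x * x) * (1 + x * x)) * u1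
  + (1 - k) * (2 - k) * (x * x) * ((1 + x * x) * (1 + x * x)) * u
  + 2 * (1 - 6 * (x * x) + x * x * (x * x)) * u.

Definition gauge (k x : C) : C := (1 + x) * (k * x - 1).

(* [x (1+x)^(-k) u] satisfies
   [(1 - x^2) y'' + 2 (k - x) y' = (2 / x^2 - 16 / (1 + x^2)^2) y], and [k - 1 / x]
   solves this without the last potential term. [reduced] is the quotient of the two up
   to the factor [(1+x)^(k-1)], which spares complex powers. *)
Definition reduced (k x u : C) : C := x * x * u / gauge k x.

(* [reduced1] and [reduced2] are the first two derivatives of [reduced] along a function [u]
   with derivatives [u1] and [u2]. *)
Definition reduced1 (k x u u1 : C) : C :=
  ((2 * x * u + x * x * u1) * gauge k x - x * x * u * (2 * k * x + k - 1))
  / (gauge k x * gauge k x).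

Definition reduced2 (k x u u1 u2 : C) : C :=
  ((2 * u + 4 * x * u1 + x * x * u2) * gauge k x - x * x * u * (2 * k))
  / (gauge k x * gauge k x)
  - 2 * (2 * k * x + k - 1)
    * ((2 * x * u + x * x * u1) * gauge k x - x * x * u * (2 * k * x + k - 1))
    / (gauge k x * gauge k x * gauge k x).

(** This is [(1 - x^2) h'' + 2 c h' + q h = 0] conjugated by [(1+x)^(k-1)], whose logarithmic
    derivative is [g]: each derivative [D] becomes [D - g]. Keeping [1 - x * x] as a factor leaves
    the identity meaningful at [x = 1]. *)
Lemma reduced_equation (k x u u1 u2 : C) :
  x <> 0 -> 1 + x <> 0 -> k * x - 1 <> 0 -> 1 + x * x <> 0 ->
  cleared_equation k x u u1 u2 = 0 ->
  let g := (k - 1) / (1 + x) in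
  let c := k - x + (1 - x * x) / (x * (k * x - 1)) in
  (1 - x * x) * reduced2 k x u u1 u2 =
  (2 * g * (1 - x * x) - 2 * c) * reduced1 k x u u1
  + ((1 - x * x) * (- (k - 1) / ((1 + x) * (1 + x)) - g * g) + 2 * c * g
     - 16 / ((1 + x * x) * (1 + x * x))) * reduced k x u.
Proof.
intros Hx H1 H2 H3 Hp g c; unfold g, c; clear g c.
apply Ceq_minus.
(* The difference of the two sides is an explicit multiple of the cleared equation. *)
transitivity (- cleared_equation k x u u1 u2
   / ((1 + x * x) * (1 + x * x) * gauge k x)).
- unfold reduced, reduced1, reduced2, cleared_equation, gauge; field; repeat split; assumption.
- rewrite Hp; unfold gauge; field; repeat split; assumption.
Qed.

End Algebra.

(** * Slow approximation and its residual *)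

Definition potential (x : R) : R := 16 / (1 + x ^ 2) ^ 2.

Definition lorentz (T x : R) : R := / (1 + T ^ 2 * x ^ 2).

(* Near [x = 1] this is half of [potential]; the factor [(T^2 + 1) x^2 lorentz] differs from
   [1] by [(1 - x^2) lorentz], so it can be divided by [1 - x^2]. *)
Definition slow_num (T x : R) : R := potential x * ((T ^ 2 + 1) * x ^ 2 * lorentz T x) / 2.

Definition slow_num1 (T x : R) : R :=
  potential x * (T ^ 2 + 1) * (x * lorentz T x ^ 2)
  - 2 * potential x * ((T ^ 2 + 1) * x ^ 2 * lorentz T x) * (x / (1 + x ^ 2)).

Lemma is_derive_slow_num T x : is_derive (slow_num T) x (slow_num1 T x).
Proof.
unfold slow_num, slow_num1, potential, lorentz; auto_derive.
- repeat split; nra.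
- field; nra.
Qed.

Section Bounds.
Variables T x : R.
Hypotheses (HT : 380 <= T) (Hx : 0 < x < 1).

(** The second and third bounds both expand [(1 - T x)^2 >= 0], the last one [1 - x^2 >= 0]. The
    majorant [2 / (1 + T x)^2] has a rational antiderivative. *)
Lemma lorentz_bounds :
  0 < lorentz T x /\ lorentz T x <= 2 / (1 + T * x) ^ 2 /\ x * lorentz T x <= 1 / (2 * T)
  /\ (T ^ 2 + 1) * x ^ 2 * lorentz T x <= 1.
Proof.
assert (HTx : 0 < T * x) by nra.
assert (Hd : 0 < 1 + T ^ 2 * x ^ 2) by nra.
assert (Hw : lorentz T x * (1 + T ^ 2 * x ^ 2) = 1) by (unfold lorentz; field; lra).
assert (Hp : 0 < lorentz T x) by apply Rinv_0_lt_compat, Hd.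
assert (Hs : 0 <= lorentz T x * (1 - T * x) ^ 2) by (apply Rmult_le_pos; [lra|apply pow2_ge_0]).
assert (Hs' : 0 <= lorentz T x * (1 - x ^ 2)) by (apply Rmult_le_pos; nra).
split; [exact Hp|split; [|split]].
- apply Rle_div_r; [apply pow_lt; lra|lra].
- rewrite <- Rle_div_r; lra.
- lra.
Qed.

Lemma potential_bounds : 0 < potential x <= 16 /\ (1 + x) ^ 3 * potential x <= 36.
Proof.
assert (Hd : 1 <= (1 + x ^ 2) ^ 2) by nra.
assert (Hq : potential x * (1 + x ^ 2) ^ 2 = 16) by (unfold potential; field; nra).
assert (0 < potential x) by (unfold potential; apply Rdiv_lt_0_compat; lra).
split; [nra|].
(* The maximum of [(1+x)^3 * potential x] is about 35.5, at [x = sqrt 7 - 2]; the two squares below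
   vanish near that point. *)
assert (Hp : 16 * (1 + x) ^ 3 <= 36 * (1 + x ^ 2) ^ 2).
{ pose proof (pow2_ge_0 (3 * x ^ 2 - 2 / 3 * x - 0.9)).
  pose proof (pow2_ge_0 (x - 0.6)); lra. }
apply (Rmult_le_reg_r ((1 + x ^ 2) ^ 2)); nra.
Qed.

Lemma slow_num_bounds : 0 <= slow_num T x <= potential x / 2.
Proof.
destruct lorentz_bounds as [Hw [_ [_ Hm]]]; destruct potential_bounds as [[Hq _] _].
assert (0 <= (T ^ 2 + 1) * x ^ 2 * lorentz T x) by (apply Rmult_le_pos; nra).
unfold slow_num; nra.
Qed.

(** Residual of the approximate slope [b] in the Riccati equation
    [b' + b^2 + (2 c b + q) / (1 - x^2) = 0], with the division by [1 - x^2] carried out. *)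
Definition residual (k : C) : C :=
  (- RtoC (slow_num1 T x) / (k - RtoC x)
   - RtoC (slow_num T x) / ((k - RtoC x) * (k - RtoC x))
   + RtoC (slow_num T x) * RtoC (slow_num T x) / ((k - RtoC x) * (k - RtoC x))
   + RtoC (potential x) * RtoC (lorentz T x)
   - 2 * RtoC (slow_num T x) / (RtoC x * (k * RtoC x - 1) * (k - RtoC x)))%C.

(** The five terms add up to at most [q (2.6 w + 1.02 / T)]. The weight [(1+x)^3] is the one under
    which the defect is integrated; with [(1+x)^3 q <= 36] and [w <= 2 / (1 + T x)^2] the constants
    are [36 * 1.02 <= 37] and [72 * 2.6 <= 188]. *)
Lemma residual_bound (k : C) :
  T <= Cmod (k - RtoC x) -> T * x <= Cmod (k * RtoC x - 1) ->
  (1 + x) ^ 3 * Cmod (residual k) <= 37 / T + 188 / (1 + T * x) ^ 2.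
Proof.
intros Ha He.
destruct lorentz_bounds as [Hw [Hw2 [Hxw Hm]]]; destruct potential_bounds as [[Hq Hq16] Hq36].
destruct slow_num_bounds as [Hs0 Hs].
set (q := potential x) in *; set (w := lorentz T x) in *.
set (s := slow_num T x) in *.
assert (Hs1 : Rabs (slow_num1 T x) <= q * (T ^ 2 + 1) * (w / (2 * T)) + q).
{ unfold slow_num1; fold q w.
  assert (0 <= (T ^ 2 + 1) * x ^ 2 * w) by (apply Rmult_le_pos; nra).
  assert (Hx1 : 0 < x / (1 + x ^ 2) <= 1 / 2).
  { split; [apply Rdiv_lt_0_compat; nra|].
    apply (Rmult_le_reg_r (1 + x ^ 2)); [nra|]; field_simplify; nra. }
  assert (H1 : 0 <= q * (T ^ 2 + 1) * (x * w ^ 2) <= q * (T ^ 2 + 1) * (w / (2 * T))).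
  { split.
    - apply Rmult_le_pos; [nra|]; apply Rmult_le_pos; lra || nra.
    - apply Rmult_le_compat_l; [nra|].
      replace (w / (2 * T)) with (w * (1 / (2 * T))) by (field; lra).
      nra. }
  assert (H2 : 0 <= 2 * q * ((T ^ 2 + 1) * x ^ 2 * w) * (x / (1 + x ^ 2)) <= q).
  { split.
    - apply Rmult_le_pos; [apply Rmult_le_pos|]; lra.
    - assert (0 <= ((T ^ 2 + 1) * x ^ 2 * w) * (x / (1 + x ^ 2)) <= 1 * (1 / 2)).
      { split; [apply Rmult_le_pos; lra|apply Rmult_le_compat; lra]. }
      nra. }
  apply Rabs_le; lra. }
assert (Haa : T * T <= Cmod ((k - RtoC x) * (k - RtoC x))).
{ rewrite Cmod_mult; apply Rmult_le_compat; lra. }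
assert (HTx : 0 < T * x) by nra.
assert (Hxea : x * (T * x) * T <= Cmod (RtoC x * (k * RtoC x - 1) * (k - RtoC x))).
{ rewrite !Cmod_mult, Cmod_R, (Rabs_pos_eq x) by lra.
  apply Rmult_le_compat; nra. }
assert (B1 : Cmod (- RtoC (slow_num1 T x) / (k - RtoC x)) <= (q * (T ^ 2 + 1) * (w / (2 * T)) + q) / T).
{ rewrite <- RtoC_opp.
  apply Rle_trans with (1 := Cmod_quot_le _ T _ ltac:(lra) Ha); rewrite Rabs_Ropp.
  apply Rmult_le_compat_r; [apply Rlt_le, Rinv_0_lt_compat; lra|exact Hs1]. }
assert (B2 : Cmod (RtoC s / ((k - RtoC x) * (k - RtoC x))) <= (q / 2) / (T * T)).
{ apply Rle_trans with (1 := Cmod_quot_le _ (T * T) _ ltac:(nra) Haa).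
  apply Rmult_le_compat_r; [apply Rlt_le, Rinv_0_lt_compat; nra|].
  rewrite Rabs_pos_eq; assumption. }
(* Here [s <= q / 2] and [q <= 16] give [s^2 <= 4 q]. *)
assert (B3 : Cmod (RtoC s * RtoC s / ((k - RtoC x) * (k - RtoC x))) <= (4 * q) / (T * T)).
{ rewrite <- RtoC_mult.
  apply Rle_trans with (1 := Cmod_quot_le _ (T * T) _ ltac:(nra) Haa).
  apply Rmult_le_compat_r; [apply Rlt_le, Rinv_0_lt_compat; nra|].
  rewrite Rabs_pos_eq; nra. }
assert (B4 : Cmod (RtoC q * RtoC w) <= q * w).
{ rewrite <- RtoC_mult, Cmod_R, Rabs_pos_eq; nra. }
(* The factor [x^2] of [slow_num] cancels the singularity [1 / x^2] of this term. *)
assert (B5 : Cmod (2 * RtoC s / (RtoC x * (k * RtoC x - 1) * (k - RtoC x)))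
   <= q * (1 + 1 / (T * T)) * w).
{ rewrite <- RtoC_mult.
  apply Rle_trans with (1 := Cmod_quot_le _ (x * (T * x) * T) _ ltac:(nra) Hxea).
  rewrite Rabs_pos_eq by lra.
  unfold s, slow_num; fold q w; apply Req_le; field; lra. }
assert (HE : Cmod (residual k) <= q * (2.6 * w + 1.02 / T)).
{ unfold residual; fold q w s.
  eapply Rle_trans; [apply Cmod_triangle|]; rewrite Cmod_opp.
  eapply Rle_trans; [apply Rplus_le_compat_r, Cmod_triangle|].
  eapply Rle_trans; [apply Rplus_le_compat_r, Rplus_le_compat_r, Cmod_triangle|].
  eapply Rle_trans; [apply Rplus_le_compat_r, Rplus_le_compat_r, Rplus_le_compat_r, Cmod_triangle|].
  rewrite Cmod_opp.
  assert (Hi : 0 < / T <= 1 / 380).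
  { split; [apply Rinv_0_lt_compat; lra|].
    replace (1 / 380) with (/ 380) by lra; apply Rinv_le_contravar; lra. }
  apply Rle_trans with ((q * (T ^ 2 + 1) * (w / (2 * T)) + q) / T + (q / 2) / (T * T)
    + (4 * q) / (T * T) + q * w + q * (1 + 1 / (T * T)) * w); [lra|].
  replace (_ + q * (1 + 1 / (T * T)) * w) with
    (q * (w * (5 / 2 + 3 / 2 * / T * / T) + / T * (1 + 9 / 2 * / T))) by (field; lra).
  apply Rmult_le_compat_l; [lra|].
  assert (Hii : / T * / T <= / T * (1 / 380)) by (apply Rmult_le_compat_l; lra).
  assert (w * (/ T * / T) <= w * (1 / 380)) by (apply Rmult_le_compat_l; lra).
  unfold Rdiv in *; lra. }
assert (Hc : 0 < (1 + x) ^ 3) by (apply pow_lt; lra).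
assert (Hi : 0 < / T) by (apply Rinv_0_lt_compat; lra).
apply Rle_trans with ((1 + x) ^ 3 * (q * (2.6 * w + 1.02 / T))).
{ apply Rmult_le_compat_l; lra. }
apply Rle_trans with (36 * (2.6 * w + 1.02 / T)).
{ rewrite <- Rmult_assoc; apply Rmult_le_compat_r; [unfold Rdiv; nra|exact Hq36]. }
unfold Rdiv in *; lra.
Qed.

End Bounds.

(* Approximate solution of the Riccati equation for [y' / y], exact to leading
   order in [1 / k] and at [x = 1]. *)
Definition slow_slope (T : R) (k : C) (x : R) : C := (- RtoC (slow_num T x) / (k - RtoC x))%C.

(* Logarithmic derivative of the factor [(1+x)^(k-1)] left out of [reduced]. *)
Definition phase_slope (k : C) (x : R) : C := ((k - 1) / (1 + RtoC x))%C.

(** Equal to [(1+x)^(k-1) (h' - b h)], where [reduced] is [(1+x)^(k-1) h] and [b] is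
    [slow_slope]. *)
Definition defect (T : R) (k : C) (x : R) (u u1 : C) : C :=
  (reduced1 k (RtoC x) u u1 - (slow_slope T k x + phase_slope k x) * reduced k (RtoC x) u)%C.

Definition defect_rate (T : R) (k : C) (x : R) : C :=
  (phase_slope k x - 2 * (k - RtoC x) / (1 - RtoC x * RtoC x)
   - 2 / (RtoC x * (k * RtoC x - 1)) - slow_slope T k x)%C.

(** Factorization of the second-order operator: [(D + 2 c / d + b) (D - b) h] equals [h'' + (2 c /
    d) h' - (b' + b^2 + 2 c b / d) h]. The equation turns this into minus the Riccati residual times
    [h]; conjugation replaces [D] by [D - g]. *)
Lemma defect_identity (k b b1 g g1 c d h h1 h2 q : C) :
  (d <> 0 -> d * h2 = (2 * g * d - 2 * c) * h1 + (d * (g1 - g * g) + 2 * c * g - q) * h ->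
  h2 - (b1 + g1) * h - (b + g) * h1
  = (g - 2 * c / d - b) * (h1 - (b + g) * h) - (b1 + b * b + (2 * c * b + q) / d) * h)%C.
Proof.
intros Hd E.
assert (E' : h2 = (((2 * g * d - 2 * c) * h1 + (d * (g1 - g * g) + 2 * c * g - q) * h) / d)%C).
{ rewrite <- E; field; exact Hd. }
rewrite E'; field; exact Hd.
Qed.

Lemma residual_eq (T x : R) (k : C) :
  380 <= T -> 0 < x < 1 -> (k - RtoC x <> 0)%C -> (k * RtoC x - 1 <> 0)%C ->
  ((- RtoC (slow_num1 T x) / (k - RtoC x) - RtoC (slow_num T x) / ((k - RtoC x) * (k - RtoC x)))
   + slow_slope T k x * slow_slope T k x
   + (2 * (k - RtoC x + (1 - RtoC x * RtoC x) / (RtoC x * (k * RtoC x - 1))) * slow_slope T k x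
      + RtoC (potential x)) / (1 - RtoC x * RtoC x) = residual T x k)%C.
Proof.
intros HT Hx Ha He.
(* By this form of [slow_num], [2 (k - x) b + q] equals [q (1 - x^2)] times [lorentz], so the
   division by [1 - x^2] is exact. *)
assert (Hm : (2 * RtoC (slow_num T x) = RtoC (potential x) * (1 - RtoC (lorentz T x) * (1 - RtoC x * RtoC x)))%C).
{ rewrite <- !RtoC_mult, <- !RtoC_minus, <- !RtoC_mult, <- !RtoC_minus, <- !RtoC_mult; f_equal.
  unfold slow_num, lorentz; field; nra. }
assert (HX : RtoC x <> RtoC 0) by (intros E; apply RtoC_inj in E; lra).
assert (HD : (1 - RtoC x * RtoC x <> 0)%C).
{ rewrite <- RtoC_mult, <- RtoC_minus; intros E; apply RtoC_inj in E; nra. }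
unfold slow_slope, residual.
assert (Hs : (RtoC (slow_num T x) = RtoC (potential x) * (1 - RtoC (lorentz T x) * (1 - RtoC x * RtoC x)) / 2)%C).
{ rewrite <- Hm; field; intros E; apply RtoC_inj in E; lra. }
rewrite Hs.
field; repeat split; try assumption; intros E; apply RtoC_inj in E; lra.
Qed.

Lemma mode_equation_cleared (lam : C) (u : R -> C) (x : R) :
  0 < x -> mode_equation lam u x ->
  cleared_equation (1 - lam) (RtoC x) (u x) (CDerive_n u 1 x) (CDerive_n u 2 x) = RtoC 0.
Proof.
intros Hx; unfold mode_equation, cleared_equation.
generalize (u x) (CDerive_n u 1 x) (CDerive_n u 2 x); intros y y1 y2 H.
assert (HX : RtoC x <> RtoC 0) by (apply RtoC_neq0; lra).
assert (HX1 : (1 + RtoC x * RtoC x <> 0)%C).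
{ rewrite <- RtoC_mult, <- RtoC_plus; apply RtoC_neq0; nra. }
assert (E1 : RtoC (1 - x ^ 2) = (1 - RtoC x * RtoC x)%C).
{ rewrite <- RtoC_mult, <- RtoC_minus; f_equal; ring. }
assert (E2 : RtoC (2 * ((1 - x ^ 2) / x)) = (2 * (1 - RtoC x * RtoC x) / RtoC x)%C).
{ rewrite <- E1, <- RtoC_mult, <- RtoC_div by lra; f_equal; field; lra. }
assert (E3 : RtoC (V x / x ^ 2) = (2 * (1 - 6 * (RtoC x * RtoC x) + RtoC x * RtoC x * (RtoC x * RtoC x))
   / ((1 + RtoC x * RtoC x) * (1 + RtoC x * RtoC x) * (RtoC x * RtoC x)))%C).
{ rewrite V_rational.
  rewrite <- !RtoC_mult, <- RtoC_minus, <- !RtoC_plus, <- !RtoC_mult, <- RtoC_div.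
  - f_equal; field; split; nra.
  - apply Rgt_not_eq; repeat apply Rmult_lt_0_compat; nra. }
rewrite E1, E2, E3 in H.
transitivity (RtoC x * RtoC x * ((1 + RtoC x * RtoC x) * (1 + RtoC x * RtoC x)) * RtoC 0)%C;
  [rewrite <- H; field; split; assumption | ring].
Qed.

(** * Integral estimates *)

Section Mode.
Variables (T : R) (k : C).
Hypotheses (HT : 380 <= T) (HkT : Rabs (Im k) = T) (Hk : 0 <= Re k <= 1).

Lemma Cmod_shift (x : R) : T <= Cmod (k - RtoC x).
Proof.
rewrite <- HkT; apply Rle_trans with (2 := Im_le_Cmod _).
right; f_equal; simpl; unfold Im; ring.
Qed.

Lemma Cmod_dilate (x : R) : 0 <= x -> T * x <= Cmod (k * RtoC x - 1).
Proof.
intros Hx.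
rewrite <- HkT, <- (Rabs_pos_eq x) at 1 by exact Hx.
rewrite <- Rabs_mult; apply Rle_trans with (2 := Im_le_Cmod _).
right; f_equal; simpl; unfold Im; ring.
Qed.

Lemma shift_neq0 (x : R) : (k - RtoC x <> 0)%C.
Proof. apply Cmod_gt_0; pose proof (Cmod_shift x); lra. Qed.

Lemma dilate_neq0 (x : R) : 0 <= x -> (k * RtoC x - 1 <> 0)%C.
Proof.
intros Hx; destruct (Req_dec x 0) as [->|N].
- intros E; apply (f_equal Re) in E; simpl in E; lra.
- apply Cmod_gt_0; pose proof (Cmod_dilate x Hx); nra.
Qed.

Lemma one_plus_neq0 (x : R) : 0 <= x -> (1 + RtoC x <> 0)%C.
Proof. intros Hx; rewrite <- RtoC_plus; apply RtoC_neq0; lra. Qed.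

Lemma one_plus_sq_neq0 (x : R) : (1 + RtoC x * RtoC x <> 0)%C.
Proof. rewrite <- RtoC_mult, <- RtoC_plus; apply RtoC_neq0; nra. Qed.

Lemma gauge_neq0 (x : R) : 0 <= x -> gauge k (RtoC x) <> RtoC 0.
Proof. intros Hx; apply Cmult_neq_0; [apply one_plus_neq0|apply dilate_neq0]; exact Hx. Qed.

Lemma slow_slope_bound (x : R) : 0 < x < 1 -> Cmod (slow_slope T k x) <= 8 / T.
Proof.
intros Hx; unfold slow_slope; rewrite <- RtoC_opp.
apply Rle_trans with (1 := Cmod_quot_le _ T _ ltac:(lra) (Cmod_shift x)).
destruct (slow_num_bounds T x HT Hx) as [H1 H2]; destruct (potential_bounds x Hx) as [H3 _].
rewrite Rabs_Ropp, Rabs_pos_eq by exact H1.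
apply Rmult_le_compat_r; [apply Rlt_le, Rinv_0_lt_compat; lra|lra].
Qed.

Lemma inv_T_bound : 0 < / T <= 1 / 380.
Proof.
split; [apply Rinv_0_lt_compat; lra|].
replace (1 / 380) with (/ 380) by lra; apply Rinv_le_contravar; lra.
Qed.

Lemma Re_phase_slope (x : R) : 0 <= x -> Re (phase_slope k x) = (Re k - 1) / (1 + x).
Proof.
intros Hx; unfold phase_slope; rewrite <- RtoC_plus, Re_div_real by lra.
simpl; unfold Re; f_equal; ring.
Qed.

(* At [x = 1] the singular part is [2 (1 - Re k) / (1 - x^2) >= 0]: this is where
   [0 <= Re lam] enters. *)
Lemma Re_defect_rate (x : R) : 0 < x < 1 -> 0 <= 3 / (1 + x) + Re (defect_rate T k x).
Proof.
intros Hx.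
assert (Hb : Re (slow_slope T k x) <= 1 / 4).
{ apply Rle_trans with (1 := Rle_abs _), Rle_trans with (1 := re_le_Cmod _).
  apply Rle_trans with (1 := slow_slope_bound x Hx).
  pose proof inv_T_bound; unfold Rdiv; lra. }
assert (H1 : Re (2 * (k - RtoC x) / (1 - RtoC x * RtoC x))%C = 2 * (Re k - x) / (1 - x * x)).
{ rewrite <- RtoC_mult, <- RtoC_minus, Re_div_real by nra.
  f_equal; simpl; unfold Re; ring. }
(* The sign is that of [Re (k x - 1) = x Re k - 1], which is negative because [Re k <= 1]. *)
assert (H2 : Re (2 / (RtoC x * (k * RtoC x - 1)))%C <= 0).
{ pose proof (dilate_neq0 x ltac:(lra)) as He.
  replace (2 / (RtoC x * (k * RtoC x - 1)))%C with ((2 / (k * RtoC x - 1)) / RtoC x)%C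
    by (field; split; [exact He|apply RtoC_neq0; lra]).
  rewrite Re_div_real by lra.
  apply Rle_div_l; [lra|]; rewrite Rmult_0_l.
  set (e := (k * RtoC x - 1)%C) in *.
  assert (Hre : Re e <= 0).
  { unfold e; simpl; unfold Re, Im in *; nra. }
  pose proof (Csq_neq0 _ He) as Hn.
  assert (0 < Re e ^ 2 + Im e ^ 2) by nra.
  replace (Re (2 / e)%C) with (2 * Re e / (Re e ^ 2 + Im e ^ 2)).
  - apply Rle_div_l; [lra|]; lra.
  - revert Hn; destruct e as [e1 e2]; simpl; intros Hn; field; rewrite ?Rmult_1_r in Hn; exact Hn. }
assert (Hc : Re (defect_rate T k x) = Re (phase_slope k x) - Re (2 * (k - RtoC x) / (1 - RtoC x * RtoC x))%C
   - Re (2 / (RtoC x * (k * RtoC x - 1)))%C - Re (slow_slope T k x)).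
{ unfold defect_rate; reflexivity. }
rewrite Hc, H1, Re_phase_slope by lra.
(* The sum is [(2 - Re k (1 + x)) / (1 - x^2) >= 1 / (1 + x) >= 1 / 2], which leaves room for the
   slope term, at most [1 / 4]. *)
enough (1 / 2 <= 3 / (1 + x) + (Re k - 1) / (1 + x) - 2 * (Re k - x) / (1 - x * x)) by lra.
replace (_ - _) with ((2 - Re k * (1 + x)) / (1 - x * x)) by (field; split; nra).
rewrite <- Rle_div_r; nra.
Qed.

(** * Differential equation of the defect *)

Lemma cderive_gauge (x : R) :
  cderive (fun t => gauge k (RtoC t)) x (2 * k * RtoC x + k - 1)%C.
Proof.
unfold gauge; eapply cderive_eq.
- apply cderive_mult.
  + apply cderive_plus; [apply cderive_const|apply cderive_id].
  + apply cderive_minus; [|apply cderive_const].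
    apply cderive_mult; [apply cderive_const|apply cderive_id].
- cbv beta; ring.
Qed.

Lemma cderive_reduced (v0 : R -> C) (x : R) (u1 : C) :
  0 <= x -> cderive v0 x u1 ->
  cderive (fun t => reduced k (RtoC t) (v0 t)) x (reduced1 k (RtoC x) (v0 x) u1).
Proof.
intros Hx H; unfold reduced; eapply cderive_eq.
- apply cderive_div; [|apply cderive_gauge|apply gauge_neq0, Hx].
  apply cderive_mult; [|exact H].
  apply cderive_mult; apply cderive_id.
- cbv beta; unfold reduced1; pose proof (gauge_neq0 x Hx); field; assumption.
Qed.

Lemma cderive_reduced1 (v0 v1 : R -> C) (x : R) (u2 : C) :
  0 <= x -> cderive v0 x (v1 x) -> cderive v1 x u2 ->
  cderive (fun t => reduced1 k (RtoC t) (v0 t) (v1 t)) x (reduced2 k (RtoC x) (v0 x) (v1 x) u2).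
Proof.
intros Hx H0 H1; unfold reduced1; eapply cderive_eq.
- apply cderive_div.
  + apply cderive_minus; apply cderive_mult.
    * apply cderive_plus; apply cderive_mult; [|exact H0| |exact H1];
        apply cderive_mult; first [apply cderive_id|apply cderive_const].
    * apply cderive_gauge.
    * apply cderive_mult; [|exact H0]; apply cderive_mult; apply cderive_id.
    * apply cderive_minus; [|apply cderive_const].
      apply cderive_plus; [|apply cderive_const].
      apply cderive_mult; [apply cderive_const|apply cderive_id].
  + apply cderive_mult; apply cderive_gauge.
  + apply Cmult_neq_0; apply gauge_neq0, Hx.
- cbv beta; unfold reduced2; pose proof (gauge_neq0 x Hx); field; assumption.
Qed.

Lemma cderive_slow_slope (x : R) :
  cderive (slow_slope T k) x
   (- RtoC (slow_num1 T x) / (k - RtoC x) - RtoC (slow_num T x) / ((k - RtoC x) * (k - RtoC x)))%C.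
Proof.
unfold slow_slope; eapply cderive_eq.
- apply cderive_div.
  + apply cderive_opp, cderive_RtoC, is_derive_slow_num.
  + apply cderive_minus; [apply cderive_const|apply cderive_id].
  + apply shift_neq0.
- cbv beta; pose proof (shift_neq0 x); field; assumption.
Qed.

Lemma cderive_phase_slope (x : R) :
  0 <= x -> cderive (phase_slope k) x (- (k - 1) / ((1 + RtoC x) * (1 + RtoC x)))%C.
Proof.
intros Hx; unfold phase_slope; eapply cderive_eq.
- apply cderive_div; [apply cderive_const| |apply one_plus_neq0, Hx].
  apply cderive_plus; [apply cderive_const|apply cderive_id].
- cbv beta; pose proof (one_plus_neq0 x Hx); field; assumption.
Qed.

Lemma cderive_defect (v0 v1 : R -> C) (x : R) (u2 : C) :
  0 < x < 1 -> cderive v0 x (v1 x) -> cderive v1 x u2 ->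
  cleared_equation k (RtoC x) (v0 x) (v1 x) u2 = RtoC 0 ->
  cderive (fun t => defect T k t (v0 t) (v1 t)) x
    (defect_rate T k x * defect T k x (v0 x) (v1 x)
     - residual T x k * reduced k (RtoC x) (v0 x))%C.
Proof.
intros Hx H0 H1 Heq.
assert (Hx0 : 0 <= x) by lra.
assert (HX : RtoC x <> RtoC 0) by (apply RtoC_neq0; lra).
assert (HD : (1 - RtoC x * RtoC x <> 0)%C).
{ rewrite <- RtoC_mult, <- RtoC_minus; apply RtoC_neq0; nra. }
pose proof (reduced_equation k (RtoC x) (v0 x) (v1 x) u2 HX (one_plus_neq0 x Hx0)
  (dilate_neq0 x Hx0) (one_plus_sq_neq0 x) Heq) as HH.
cbv zeta in HH.
unfold defect; eapply cderive_eq.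
- apply cderive_minus; [apply cderive_reduced1; [exact Hx0|exact H0|exact H1]|].
  apply cderive_mult; [|apply cderive_reduced; [exact Hx0|exact H0]].
  apply cderive_plus; [apply cderive_slow_slope|apply cderive_phase_slope, Hx0].
- cbv beta; rewrite <- (residual_eq T x k HT Hx (shift_neq0 x) (dilate_neq0 x Hx0)).
  replace (RtoC (potential x)) with (16 / ((1 + RtoC x * RtoC x) * (1 + RtoC x * RtoC x)))%C.
  2:{ rewrite <- !RtoC_mult, <- !RtoC_plus, <- !RtoC_mult, <- RtoC_div by nra.
      unfold potential; f_equal; field; nra. }
  fold (phase_slope k x) in HH.
  set (c := (k - RtoC x + (1 - RtoC x * RtoC x) / (RtoC x * (k * RtoC x - 1)))%C) in *.
  assert (Hcoef : defect_rate T k x = (phase_slope k x - 2 * c / (1 - RtoC x * RtoC x) - slow_slope T k x)%C).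
  { unfold defect_rate, c; field; repeat split; [exact (dilate_neq0 x Hx0)|exact HX|exact HD]. }
  rewrite Hcoef, <- (defect_identity k _ _ _ _ _ _ _ _ _ _ HD HH).
  ring.
Qed.

(** At [x = 1] the coefficient of [h''] vanishes and the equation becomes [2 c h' + q h = 0] with
    [c = k - 1] and [q = 4]. There [b = - 2 / (k - 1)] is exactly [- q / (2 c)]. *)
Lemma defect_at_1 (u u1 u2 : C) :
  cleared_equation k (RtoC 1) u u1 u2 = RtoC 0 -> defect T k 1 u u1 = RtoC 0.
Proof.
intros Heq.
pose proof (reduced_equation k (RtoC 1) u u1 u2 C1_nz (one_plus_neq0 1 Rle_0_1)
  (dilate_neq0 1 Rle_0_1) (one_plus_sq_neq0 1) Heq) as HH.
cbv zeta in HH.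
unfold defect, slow_slope, phase_slope.
replace (RtoC (slow_num T 1)) with (RtoC 2)
  by (f_equal; unfold slow_num, potential, lorentz; field; nra).
pose proof (shift_neq0 1) as Ha; pose proof (one_plus_neq0 1 Rle_0_1) as H2.
generalize dependent (reduced k (RtoC 1) u); intros h.
generalize (reduced1 k (RtoC 1) u u1) (reduced2 k (RtoC 1) u u1 u2); intros h1 h2 HH.
pose proof (dilate_neq0 1 Rle_0_1) as He.
apply Ceq_minus in HH.
match type of HH with ?L = _ => transitivity (L / (2 * (k - 1)))%C end.
- field; repeat split; assumption.
- rewrite HH; field; exact Ha.
Qed.

Lemma ccont_gauge (x : R) : ccont (fun t => gauge k (RtoC t)) x.
Proof. apply (cderive_ccont _ _ _ (cderive_gauge x)). Qed.

Lemma ccont_reduced (v0 : R -> C) (x : R) :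
  0 <= x -> ccont v0 x -> ccont (fun t => reduced k (RtoC t) (v0 t)) x.
Proof.
intros Hx H; unfold reduced; apply ccont_div; [|apply ccont_gauge|apply gauge_neq0, Hx].
ccont_tac.
Qed.

Lemma ccont_defect (v0 v1 : R -> C) (x : R) :
  0 <= x -> ccont v0 x -> ccont v1 x -> ccont (fun t => defect T k t (v0 t) (v1 t)) x.
Proof.
intros Hx H0 H1; unfold defect.
apply ccont_minus.
- unfold reduced1; apply ccont_div.
  + pose proof (ccont_gauge x); unfold gauge in *; ccont_tac.
  + apply ccont_mult; apply ccont_gauge.
  + apply Cmult_neq_0; apply gauge_neq0, Hx.
- apply ccont_mult; [|apply ccont_reduced; assumption].
  apply ccont_plus.
  + apply (cderive_ccont _ _ _ (cderive_slow_slope x)).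
  + apply (cderive_ccont _ _ _ (cderive_phase_slope x Hx)).
Qed.

Lemma ccont_cleared_equation (v0 v1 v2 : R -> C) (x : R) :
  ccont v0 x -> ccont v1 x -> ccont v2 x ->
  ccont (fun t => cleared_equation k (RtoC t) (v0 t) (v1 t) (v2 t)) x.
Proof.
intros H0 H1 H2; unfold cleared_equation; ccont_tac.
Qed.

(** * Integration of the defect and of the quotient *)

Section Estimate.
Variables (v0 v1 v2 : R -> C).
Hypotheses (Hcont : forall x, ccont v0 x /\ ccont v1 x /\ ccont v2 x)
  (Hder : forall x, 0 < x < 1 -> cderive v0 x (v1 x) /\ cderive v1 x (v2 x))
  (Heq : forall x, 0 < x < 1 -> cleared_equation k (RtoC x) (v0 x) (v1 x) (v2 x) = RtoC 0).

Let H (x : R) : C := reduced k (RtoC x) (v0 x).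
Let r (x : R) : C := defect T k x (v0 x) (v1 x).

(** The weighted defect [z] satisfies [z' = c z - e] with [Re c >= 0], so going back from [z 1 = 0]
    its modulus grows at most by the integral of [Cmod e], which [residual_bound] controls. *)
Lemma defect_estimate (M x : R) :
  0 <= M -> (forall y, 0 <= y <= 1 -> Cmod (H y) <= M) -> 0 < x < 1 -> Cmod (r x) <= 0.6 * M.
Proof.
intros HM HH Hx.
pose proof inv_T_bound as Hi.
set (z := fun t => (RtoC ((1 + t) ^ 3) * r t)%C).
(* Smoothness up to the endpoint enters here: [v2] is continuous at 1, so the cleared equation
   passes to the limit. *)
assert (Hr1 : r 1 = RtoC 0).
{ apply (defect_at_1 _ _ (v2 1)).
  apply (ccont_zero_closure (fun t => cleared_equation k (RtoC t) (v0 t) (v1 t) (v2 t)));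
    [lra|apply ccont_cleared_equation; apply Hcont|exact Heq]. }
assert (Hpow : forall y, is_derive (fun t => (1 + t) ^ 3) y (3 * (1 + y) ^ 2)).
{ intros y; auto_derive; [trivial|ring]. }
assert (HG : -1 * (Cmod (z 1) - Cmod (z x)) <=
  M * (37 / T * 1 - 188 / (T * (1 + T * 1))) - M * (37 / T * x - 188 / (T * (1 + T * x)))).
{ apply (Cmod_growth z
    (fun y => RtoC (3 * (1 + y) ^ 2) * r y
      + RtoC ((1 + y) ^ 3) * (defect_rate T k y * r y - residual T y k * H y))%C
    (fun y => M * (37 / T * y - 188 / (T * (1 + T * y))))
    (fun y => M * (37 / T + 188 / (1 + T * y) ^ 2))); [right; reflexivity|lra| | |].
  - intros y Hy; apply ccont_mult.
    + apply (cderive_ccont _ _ _ (cderive_RtoC _ _ _ (Hpow y))).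
    + apply ccont_defect; [lra|apply Hcont|apply Hcont].
  - intros y Hy; apply derivable_continuous_pt; eexists; apply is_derive_Reals.
    auto_derive; [|reflexivity].
    apply Rgt_not_eq, Rmult_lt_0_compat; nra.
  - intros y Hy; assert (Hy1 : 0 < y < 1) by lra.
    assert (HTy : 0 < T * y) by nra.
    destruct (Hder y Hy1) as [D0 D1].
    split; [|split; [|split]].
    + apply (cderive_mult _ _ _ _ _ (cderive_RtoC _ _ _ (Hpow y))).
      apply cderive_defect with (v2 y); [exact Hy1|exact D0|exact D1|apply Heq, Hy1].
    + auto_derive; [apply Rgt_not_eq, Rmult_lt_0_compat; lra|].
      field; split; lra.
    + apply Rmult_le_pos; [exact HM|].
      assert (0 < / (1 + T * y) ^ 2) by (apply Rinv_0_lt_compat, pow_lt; lra).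
      unfold Rdiv; lra.
    + set (c := (RtoC (3 / (1 + y)) + defect_rate T k y)%C).
      set (e := (RtoC ((1 + y) ^ 3) * residual T y k * H y)%C).
      replace (_ + _ * (_ - _))%C with (c * z y - e)%C.
      2:{ unfold c, e, z.
          replace (RtoC (3 * (1 + y) ^ 2)) with (RtoC (3 / (1 + y)) * RtoC ((1 + y) ^ 3))%C.
          - ring.
          - rewrite <- RtoC_mult; f_equal; field; lra. }
      assert (Hc : 0 <= Re c).
      { apply Rle_trans with (1 := Re_defect_rate y Hy1); right; reflexivity. }
      assert (He : Cmod e <= M * (37 / T + 188 / (1 + T * y) ^ 2)).
      { unfold e; rewrite !Cmod_mult, Cmod_R, Rabs_pos_eq by (apply pow_le; lra).
        rewrite (Rmult_comm M); apply Rmult_le_compat.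
        - apply Rmult_le_pos; [apply pow_le; lra|apply Cmod_ge_0].
        - apply Cmod_ge_0.
        - apply residual_bound; [exact HT|exact Hy1|apply Cmod_shift|apply Cmod_dilate; lra].
        - apply HH; lra. }
      pose proof (dot_le_Cmod (z y) e).
      apply Rle_trans with (Cmod (z y) * Cmod e).
      * replace (Re (c * z y - e)%C) with (Re c * Re (z y) - Im c * Im (z y) - Re e)
          by (simpl; unfold Re, Im; ring).
        replace (Im (c * z y - e)%C) with (Re c * Im (z y) + Im c * Re (z y) - Im e)
          by (simpl; unfold Re, Im; ring).
        assert (0 <= Re c * (Re (z y) ^ 2 + Im (z y) ^ 2)) by (apply Rmult_le_pos; nra).
        lra.
      * rewrite Rmult_comm; apply Rmult_le_compat_r; [apply Cmod_ge_0|exact He]. }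
assert (Hz1 : Cmod (z 1) = 0) by (unfold z; rewrite Hr1, Cmult_0_r; apply Cmod_0).
assert (Hzx : Cmod (r x) <= Cmod (z x)).
{ unfold z; rewrite Cmod_mult, Cmod_R, Rabs_pos_eq by (apply pow_le; lra).
  assert (1 <= (1 + x) ^ 3) by (apply pow_R1_Rle; lra).
  pose proof (Cmod_ge_0 (r x)); nra. }
assert (Hq : 0 <= 188 / (T * (1 + T * 1))).
{ apply Rlt_le, Rdiv_lt_0_compat; nra. }
assert (Hq' : 188 / (T * (1 + T * x)) <= 188 / T).
{ apply Rmult_le_compat_l; [lra|]; apply Rinv_le_contravar; nra. }
assert (HX : 0 <= 37 / T * x) by (apply Rmult_le_pos; unfold Rdiv; lra).
(* The total is at most [(37 + 188) / T <= 225 / 380 < 0.6]. *)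
assert (37 / T * 1 - 188 / (T * (1 + T * 1)) - (37 / T * x - 188 / (T * (1 + T * x))) <= 0.6)
  by (unfold Rdiv in *; lra).
rewrite Hz1 in HG; nra.
Qed.

(** The phase term does not increase the modulus of [H], since [Re k <= 1]. Its growth rate is thus
    at most [8 M / T + 0.6 M <= 0.7 M]; integrating from [H 0 = 0] to a maximum point gives
    [M <= 0.7 M]. *)
Lemma reduced_zero (x : R) : 0 <= x <= 1 -> H x = RtoC 0.
Proof.
intros Hx.
assert (HC : forall y, 0 <= y <= 1 -> ccont H y).
{ intros y Hy; apply ccont_reduced; [lra|apply Hcont]. }
(* Maximizing the squared modulus avoids the square root. *)
destruct (continuity_ab_maj (fun y => Re (H y) * Re (H y) + Im (H y) * Im (H y)) 0 1 Rle_0_1)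
  as [y [Hmax Hy]].
{ intros c Hc; destruct (HC c Hc); apply continuity_pt_plus; apply continuity_pt_mult; assumption. }
assert (HM : forall c, 0 <= c <= 1 -> Cmod (H c) <= Cmod (H y)).
{ intros c Hc; apply sqrt_le_1_alt; specialize (Hmax c Hc); unfold Re, Im in Hmax; simpl in *; lra. }
assert (H0 : Cmod (H 0) = 0).
{ unfold H, reduced; rewrite !Cmult_0_l; unfold Cdiv; rewrite Cmult_0_l; apply Cmod_0. }
set (M := Cmod (H y)) in *.
assert (HM0 : 0 <= M) by apply Cmod_ge_0.
assert (HG : 1 * (Cmod (H y) - Cmod (H 0)) <= 0.7 * M * y - 0.7 * M * 0).
{ apply (Cmod_growth H (fun t => reduced1 k (RtoC t) (v0 t) (v1 t))
    (fun t => 0.7 * M * t) (fun _ => 0.7 * M)); [left; reflexivity|lra| | |].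
  - intros t Ht; apply HC; lra.
  - intros t Ht; apply derivable_continuous_pt; eexists; apply is_derive_Reals.
    auto_derive; [trivial|reflexivity].
  - intros t Ht; assert (Ht1 : 0 < t < 1) by lra.
    split; [|split; [|split]].
    + apply cderive_reduced; [lra|apply Hder, Ht1].
    + auto_derive; [trivial|ring].
    + lra.
    + replace (reduced1 k (RtoC t) (v0 t) (v1 t)) with ((phase_slope k t) * H t + (slow_slope T k t * H t + r t))%C
        by (unfold r, defect, H; ring).
      set (e := (slow_slope T k t * H t + r t)%C).
      assert (He : Cmod e <= 0.7 * M).
      { apply Rle_trans with (1 := Cmod_triangle _ _); rewrite Cmod_mult.
        pose proof (defect_estimate M t HM0 HM Ht1).
        pose proof (slow_slope_bound t Ht1); pose proof inv_T_bound.
        assert (Cmod (slow_slope T k t) * Cmod (H t) <= 0.1 * M).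
        { apply Rmult_le_compat; try apply Cmod_ge_0; [unfold Rdiv in *; lra|apply HM; lra]. }
        lra. }
      assert (Hg : Re (phase_slope k t) <= 0).
      { rewrite Re_phase_slope by lra; apply Rle_div_l; lra. }
      pose proof (dot_le_Cmod (H t) e).
      apply Rle_trans with (Cmod (H t) * Cmod e).
      * replace (Re (phase_slope k t * H t + e)%C) with
          (Re (phase_slope k t) * Re (H t) - Im (phase_slope k t) * Im (H t) + Re e)
          by (simpl; unfold Re, Im; ring).
        replace (Im (phase_slope k t * H t + e)%C) with
          (Re (phase_slope k t) * Im (H t) + Im (phase_slope k t) * Re (H t) + Im e)
          by (simpl; unfold Re, Im; ring).
        assert (0 <= - Re (phase_slope k t) * (Re (H t) ^ 2 + Im (H t) ^ 2)) by (apply Rmult_le_pos; nra).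
        lra.
      * rewrite Rmult_comm; apply Rmult_le_compat_r; [apply Cmod_ge_0|exact He]. }
fold M in HG; rewrite H0 in HG.
apply Cmod_eq_0; pose proof (HM x Hx); pose proof (Cmod_ge_0 (H x)); nra.
Qed.

Lemma solution_zero (x : R) : 0 < x <= 1 -> v0 x = RtoC 0.
Proof.
intros Hx; pose proof (reduced_zero x ltac:(lra)) as E; unfold H, reduced in E.
assert (HX : RtoC x <> RtoC 0) by (apply RtoC_neq0; lra).
pose proof (gauge_neq0 x ltac:(lra)) as Hg.
transitivity (RtoC x * RtoC x * v0 x / gauge k (RtoC x) * gauge k (RtoC x) / (RtoC x * RtoC x))%C.
- field; split; assumption.
- rewrite E; field; assumption.
Qed.

End Estimate.

End Mode.

(** * Absence of unstable modes *)

Theorem theorem1p2 (lam : C)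
  (hRe : 0 <= Re lam <= 1 / 2) (hIm : 380 <= Rabs (Im lam)) :
  ~ exists u : R -> C, unstable_mode lam u.
Proof.
intros [u [_ [Hs [[x [Hx Hux]] Heq]]]].
destruct (smooth_on_unit_segment u Hs) as [v0 [v1 [v2 [Hv [Hc Hd]]]]].
set (k := (1 - lam)%C).
assert (Hk : 0 <= Re k <= 1) by (unfold k; simpl; unfold Re in *; lra).
assert (HkT : Rabs (Im k) = Rabs (Im lam)).
{ rewrite <- (Rabs_Ropp (Im lam)); unfold k; simpl; f_equal; unfold Im; ring. }
assert (Hzero : forall y, 0 < y <= 1 -> v0 y = RtoC 0).
{ apply (solution_zero (Rabs (Im lam)) k hIm HkT Hk v0 v1 v2 Hc).
  - intros y Hy; split; apply Hd, Hy.
  - intros y Hy; destruct (Hd y Hy) as [_ [_ [E1 E2]]].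
    rewrite <- E1, <- E2, Hv by lra.
    apply mode_equation_cleared; [lra|apply Heq, Hy]. }
apply Hux; rewrite <- Hv by exact Hx.
(* At [x = 0] the factor [x^2] in [reduced] hides the value of the mode, which is recovered by
   continuity. *)
destruct (Req_dec x 0) as [->|N]; [|apply Hzero; lra].
apply ccont_zero_closure; [lra|apply Hc|].
intros y Hy; apply Hzero; lra.
Qed.
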